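(* Let $(X,\le)$ be a chain such that $\mathrm{Epi}(X,\le)$ is non-trivial. Then $\mathrm{Emb}(X,\le)$ is also non-trivial. Moreover, if $(X,\le)$ is a densely ordered chain, then $|\mathrm{Epi}(X,\le)| \le |\mathrm{Emb}(X,\le)|$.
   Context: The axiom of choice is assumed (we work in ZFC). A chain is a linearly ordered set. An epimorphism of $(X,\le)$ is a surjective map $f: X\to X$ such that $x\le y \Rightarrow f(x)\le f(y)$; $\mathrm{Epi}(X,\le)$ is the monoid (under composition) of all epimorphisms of $(X,\le)$. An embedding of $(X,\le)$ is a map $f: X\to X$ such that $x<y\Rightarrow f(x)<f(y)$; $\mathrm{Emb}(X,\le)$ is the monoid of all embeddings. Either monoid is called trivial if its only element is the identity map. *)

(* Defs.v *)
From HB Require Import structures.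
From mathcomp Require Import all_boot all_order.
From mathcomp Require Import boolp classical_sets functions cardinality.
Set Implicit Arguments.
Unset Strict Implicit.
Unset Printing Implicit Defensive.
Import Order.TTheory.
Local Open Scope classical_set_scope.
Local Open Scope order_scope.

(* [Epi X] and [Emb X] are submonoids of the monoid of all maps X -> X under
   composition (lemmas below), given by their sets of elements. *)
Definition Epi d (X : orderType d) : set (X -> X) :=
  [set f | {homo f : x y / x <= y} /\ set_surj setT setT f].

Definition Emb d (X : orderType d) : set (X -> X) :=
  [set f | {homo f : x y / x < y}].

Arguments Epi {d} X _.
Arguments Emb {d} X _.

Definition trivial_monoid T (M : set (T -> T)) : Prop := M = [set idfun].

Definition densely_ordered d (X : orderType d) : Prop :=
  forall x y : X, x < y -> exists z, x < z < y.

Arguments densely_ordered {d} X.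

Lemma Epi_id d (X : orderType d) : Epi X idfun.
Proof. by split=> // y _; exists y. Qed.

Lemma Epi_comp d (X : orderType d) (f g : X -> X) :
  Epi X f -> Epi X g -> Epi X (f \o g).
Proof.
move=> [fh fs] [gh gs]; split=> [x y xy|y _ /=]; first exact/fh/gh.
have [x _ <-] := fs y Logic.I; have [z _ <-] := gs x Logic.I.
by exists z.
Qed.

Lemma Emb_id d (X : orderType d) : Emb X idfun.
Proof. by []. Qed.

Lemma Emb_comp d (X : orderType d) (f g : X -> X) :
  Emb X f -> Emb X g -> Emb X (f \o g).
Proof. by move=> fh gh x y xy; exact/fh/gh. Qed.

(* Main.v *)
Require Import Defs.
From mathcomp Require Import all_boot all_order.
From mathcomp Require Import boolp classical_sets functions cardinality.
Local Open Scope classical_set_scope.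
Local Open Scope order_scope.
Local Open Scope card_scope.

(** Any section [g] of an epimorphism [f] is an embedding, and [g] is the
    identity only if [f] is.  If the chain is dense, then [g] determines [f]:
    were [f y < z < f' y] for two epimorphisms with the common section [g],
    then [g z <= y] would give [z <= f y], and [y <= g z] would give
    [f' y <= z].  So choosing a section of each epimorphism is an injection. *)

Lemma Epi_section (d : Order.disp_t) (X : orderType d) (f : X -> X) :
  Epi X f -> exists g : X -> X, cancel g f.
Proof.
move=> [_ fs]; have /boolp.choice[g gK] y : exists x, f x = y.
  by have [x _ <-] := fs y Logic.I; exists x.
by exists g.
Qed.

(** By contraposition: applying the monotone [f] to [g y <= g x] gives [y <= x]. *)
Lemma section_Emb (d : Order.disp_t) (X : orderType d) (f g : X -> X) :
  Epi X f -> cancel g f -> Emb X g.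
Proof.
move=> [fh _] gK x y; apply: contraTT.
by rewrite -!Order.TotalTheory.leNgt => /fh; rewrite !gK.
Qed.

Lemma dense_section_le (d : Order.disp_t) (X : orderType d) (f f' g : X -> X) :
  densely_ordered X -> Epi X f -> Epi X f' -> cancel g f -> cancel g f' ->
  forall y, f' y <= f y.
Proof.
move=> dX [fh _] [fh' _] gK gK' y.
rewrite Order.TotalTheory.leNgt; apply/negP => /dX [z /andP[fz zf']].
have [/fh|/fh'] := orP (Order.TotalTheory.le_total (g z) y).
  by rewrite gK Order.TotalTheory.leNgt fz.
by rewrite gK' Order.TotalTheory.leNgt zf'.
Qed.

Theorem theorem2p3 (d : Order.disp_t) (X : orderType d)
    (Epi_nontrivial : ~ trivial_monoid (Epi X)) :
  ~ trivial_monoid (Emb X) /\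
  (densely_ordered X -> Epi X #<= Emb X).
Proof.
split=> [Emb1|dX].
  apply: Epi_nontrivial; apply/seteqP; split=> f /= => [Ef|->]; last exact: Epi_id.
  have [g gK] := Epi_section _ _ _ Ef.
  have := section_Emb _ _ _ _ Ef gK; rewrite Emb1 => /= g1.
  by apply/funext => x; have := gK x; rewrite g1.
(* Choice runs over all maps [X -> X], so the condition is guarded by [Epi X f], with [idfun] as a
   dummy value elsewhere. *)
have /boolp.choice[s sK] (f : X -> X) : exists g, Epi X f -> cancel g f.
  have [/Epi_section [g gK]|nEf] := pselect (Epi X f); first by exists g.
  by exists idfun.
have s_inj : {in Epi X &, injective s}.
  move=> f f' /[!inE] Ef Ef' sff'; apply/funext => y; apply/eqP.
  have gK := sK f Ef; have gK' := sK f' Ef'; rewrite -sff' in gK'.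
  rewrite Order.POrderTheory.eq_le (dense_section_le _ _ _ _ _ dX Ef' Ef gK' gK).
  exact: (dense_section_le _ _ _ _ _ dX Ef Ef' gK gK').
(* By injectivity [Epi X] is equipotent to its image under [s], which consists of sections and so
   lies in [Emb X]. *)
rewrite -(card_le_eql (inj_card_eq s_inj)); apply: subset_card_le => _ [f Ef <-].
exact: section_Emb _ _ _ _ Ef (sK f Ef).
Qed.
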